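(* Let $p=4k+1$ be a prime. For a graph $\Gamma$ on four vertices let $n_p(\Gamma)$ be as defined in the context, and put $$J(k)=\sum_{i=1}^{4k-2}\Big(\frac{i(i+1)(i+2)}{p}\Big),\qquad d(k)=\frac{J(k)^2-4}{32}.$$ Then for each of the $11$ isomorphism classes of simple graphs $\Gamma$ on four vertices there is a polynomial $P_\Gamma\in\mathbb{Q}[u,v]$, independent of $p$, such that $n_p(\Gamma)=P_\Gamma(k,d(k))$ for all primes $p=4k+1$. In particular, for the complete graph $K_4$, $$n_p(K_4)=\frac{k(k-1)(k-4)+2k\,d(k)}{24}.$$
   Context: $\big(\frac{a}{p}\big)$ is the Legendre symbol. For $p\equiv 1\pmod 4$ and an $\ell$-tuple $A=(r_1,\ldots,r_\ell)$ of pairwise distinct residues modulo $p$, let $\Gamma_A$ be the graph on vertices $v_1,\ldots,v_\ell$ with $v_i,v_j$ joined by an edge iff $r_i-r_j$ is a nonzero quadratic residue mod $p$ (symmetric since $-1$ is a square). Two tuples are identified if they differ by a permutation of entries or by adding the same residue $a$ to all entries. For a graph $\Gamma$ on $\ell$ vertices, $n_p(\Gamma)$ is the number of such classes of tuples $A$ with $\Gamma_A$ isomorphic to $\Gamma$. *)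

(* Defs.v *)
From HB Require Import structures.
From mathcomp Require Import all_boot all_order all_algebra all_fingroup.
From mathcomp Require Export mpoly.
Set Implicit Arguments. Unset Strict Implicit. Unset Printing Implicit Defensive.
Import Order.TTheory GRing.Theory Num.Theory.
Local Open Scope ring_scope.

Definition legendre (p : nat) (a : int) : int :=
  let x : 'F_p := a%:~R in
  if x == 0 then 0 else if [exists y : 'F_p, y ^+ 2 == x] then 1 else -1.

Definition qr_adj (p : nat) (x y : 'F_p) : bool :=
  (x - y != 0) && [exists z : 'F_p, z ^+ 2 == x - y].

Definition simple_graph (l : nat) (e : rel 'I_l) : Prop :=
  (forall i, e i i = false) /\ (forall i j, e i j = e j i).

Definition graph_of (p l : nat) (A : {ffun 'I_l -> 'F_p}) : rel 'I_l :=
  fun i j => qr_adj (A i) (A j).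

Definition graph_iso (l : nat) (e1 e2 : rel 'I_l) : bool :=
  [exists s : {perm 'I_l}, [forall i, forall j, e1 i j == e2 (s i) (s j)]].

Definition tuple_equiv (p l : nat) (A B : {ffun 'I_l -> 'F_p}) : bool :=
  [exists s : {perm 'I_l}, exists a : 'F_p, [forall i, B i == A (s i) + a]].

Definition good_tuples (p l : nat) (e : rel 'I_l) : {set {ffun 'I_l -> 'F_p}} :=
  [set A : {ffun 'I_l -> 'F_p} | injectiveb A && graph_iso (graph_of A) e].

Definition n_p (p l : nat) (e : rel 'I_l) : nat :=
  #|[set [set B | tuple_equiv A B] | A in good_tuples p e]|.

Definition J (p k : nat) : int :=
  \sum_(1 <= i < (4 * k - 2).+1)
     legendre p ((i%:Z) * (i.+1)%:Z * (i.+2)%:Z).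

Definition d (p k : nat) : rat := ((J p k)%:~R ^+ 2 - 4) / 32.

Definition K4 : rel 'I_4 := fun i j => i != j.

(* Main.v *)
Require Import Defs.
From HB Require Import structures.
From mathcomp Require Import all_boot all_order all_algebra all_fingroup.
From mathcomp Require Import cyclic finfield ring lra zify.
From mathcomp Require Import mpoly.
Import GRing.Theory Num.Theory.
Local Open Scope ring_scope.

Set Implicit Arguments.
Unset Strict Implicit.
Unset Printing Implicit Defensive.

(* Permutations and translations act freely on injective 4-tuples, so n_p is the
   number of good tuples divided by 24 p.  Writing the indicator of an adjacency
   pattern as a product of factors (chi^2 +- chi) / 2 in the differences reduces
   the count to the sums, over 4-tuples of distinct residues, of a product of
   chi(r_i - r_j) over the edges of a graph S.  If S has an odd number of edges,
   scaling by a non-residue shows that the sum vanishes; if S has 0, 2 or 4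
   edges, summing over one vertex at a time is elementary.  For S = K4 the sum
   is p (p - 1) T with T = sum_{y,z} chi(y z (1-y) (1-z) (y-z)), and
   T = J^2 - 2 p.  Indeed, with a(l) the character sum of the Legendre curve
   y^2 = x (x - 1) (x - l), one finds T = sum_c chi(1 - c^2) a(c^2) - 1 and
   J^2 - 2 p = sum_t chi(t) a(t^2); the substitution c = (1 - t) / (1 + t)
   exchanges the two sums because a((1 - t)^2 / (1 + t)^2) = a(t^2), the curves
   being 2-isogenous. *)

(** * The quadratic character of a field with 4k + 1 elements *)

Section QuadraticCharacter.
Variables (F : finFieldType) (k : nat).
Hypothesis cardF : #|F| = (4 * k + 1)%N.

(** Rational values allow the indicators (chi^2 +- chi) / 2 to be formed later. *)
Definition chi (x : F) : rat :=
  if x == 0 then 0 else if [exists y : F, y ^+ 2 == x] then 1 else -1.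

(** The additive group has order 4k + 1, so 4k + 1 vanishes in F. *)
Lemma natF_eq1 : (4 * k)%:R = -1 :> F.
Proof.
have: ((1%R : F) ^+ #|[set: F]|)%g = 1%g by rewrite expg_cardG ?inE.
rewrite cardsT FinRing.zmodXgE FinRing.zmod1gE cardF natrD => /eqP.
by rewrite addr_eq0 => /eqP.
Qed.

Lemma expF_4k (x : F) : x != 0 -> x ^+ (4 * k) = 1.
Proof.
move=> x0; apply: (mulIf x0); rewrite mul1r -exprSr.
by rewrite -[RHS](expf_card x) cardF addn1.
Qed.

Lemma k_gt0 : (0 < k)%N.
Proof. by have := finNzRing_gt1 F; rewrite cardF; case: k. Qed.

Lemma exists_generator :
  exists2 g : F, (4 * k).-primitive_root g & forall x : F, x != 0 -> exists i, x = g ^+ i.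
Proof.
have : has (4 * k).-primitive_root (enum [pred x : F | x != 0]).
  apply: has_prim_root.
  - by rewrite muln_gt0 k_gt0.
  - apply/allP => x; rewrite mem_enum inE => x0; rewrite unity_rootE.
    by rewrite expF_4k.
  - exact: enum_uniq.
  - rewrite -cardE; have := cardC1 (0 : F); rewrite cardF addn1 /= => e.
    by rewrite -[X in (X <= _)%N]e.
case/hasP=> g _ gP; exists g => // x x0.
by have [i ->] := prim_rootP gP (expF_4k x0); exists i.
Qed.

Lemma euler_criterion (x : F) :
  x != 0 -> [exists y : F, y ^+ 2 == x] = (x ^+ (2 * k) == 1).
Proof.
move=> x0; apply/existsP/eqP => [[y /eqP e]|].
  rewrite -e -exprM mulnA expF_4k //.
  by apply: contraNneq x0 => y0; rewrite -e y0 expr0n.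
have [g gP gE] := exists_generator.
have [i ->] := gE x x0; rewrite -exprM => /eqP.
(* As 4k = 2 (2k) divides i (2k), the exponent i is even and x = g^i is a square. *)
rewrite -(prim_order_dvd gP) -[4%N]/(2 * 2)%N -mulnA dvdn_pmul2r ?muln_gt0 ?k_gt0 //.
case/dvdnP=> j ->; exists (g ^+ j); by rewrite exprM.
Qed.

Lemma two_neq0 : 2 != 0 :> F.
Proof.
apply: contra_eqN natF_eq1 => /eqP e.
by rewrite -[4%N]/(2 * 2)%N -mulnA natrM e mul0r eq_sym oppr_eq0 oner_eq0.
Qed.

Lemma chiE (x : F) :
  chi x = if x == 0 then 0 else if x ^+ (2 * k) == 1 then 1 else -1.
Proof. by rewrite /chi; case: eqVneq => // x0; rewrite euler_criterion. Qed.

Lemma chi0 : chi 0 = 0. Proof. by rewrite /chi eqxx. Qed.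

Lemma expF_2k_sign (x : F) : x != 0 -> x ^+ (2 * k) = 1 \/ x ^+ (2 * k) = -1.
Proof.
move=> x0; have /eqP := expF_4k x0.
rewrite -[4%N]/(2 * 2)%N -mulnA mulnC exprM sqrf_eq1.
by case/orP => /eqP; [left|right].
Qed.

Lemma chiM (x y : F) : chi (x * y) = chi x * chi y.
Proof.
rewrite !chiE mulf_eq0; case: eqVneq => [_|x0] /=; first by rewrite mul0r.
case: eqVneq => [_|y0] /=; first by rewrite mulr0.
have n1 : (-1 == 1 :> F) = false.
  by apply/negbTE; rewrite -subr_eq0 -opprD oppr_eq0 two_neq0.
rewrite exprMn.
by case: (expF_2k_sign x0) => ->; case: (expF_2k_sign y0) => ->;
  rewrite ?mulrNN ?mulr1 ?mul1r ?eqxx ?n1 ?mulrNN ?mulr1.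
Qed.

Lemma chi1 : chi 1 = 1.
Proof. by rewrite chiE oner_eq0 expr1n eqxx. Qed.

(** The exponent 2k is even because the order is 1 modulo 4, so chi(-1) = 1. *)
Lemma chiN (x : F) : chi (- x) = chi x.
Proof.
have -> : - x = -1 * x by rewrite mulN1r.
rewrite chiM chiE oppr_eq0 oner_eq0 exprM sqrrN !expr1n eqxx.
by rewrite mul1r.
Qed.

Lemma chiB (x y : F) : chi (x - y) = chi (y - x).
Proof. by rewrite -chiN opprB. Qed.

Lemma chi2E (x : F) : chi x ^+ 2 = (x != 0)%:R.
Proof.
by rewrite /chi; case: eqVneq => // _; case: ifP; rewrite ?sqrrN expr1n.
Qed.

Lemma chi_sqr (x : F) : chi (x ^+ 2) = (x != 0)%:R.
Proof. by rewrite expr2 chiM -expr2 chi2E. Qed.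

Lemma chiV (x : F) : chi x^-1 = chi x.
Proof.
have [->|x0] := eqVneq x 0; first by rewrite invr0.
have -> : x^-1 = x * (x^-1) ^+ 2 by field.
by rewrite chiM chi_sqr invr_neq0 // mulr1.
Qed.

(** * Elementary character sums *)

Lemma sum_delta (f : F -> rat) (a : F) : \sum_x (x == a)%:R * f x = f a.
Proof.
rewrite (bigD1 a) //= eqxx mul1r big1 ?addr0 // => x /negbTE ->.
by rewrite mul0r.
Qed.

Lemma card_sqrts (x : F) : \sum_(y : F) (y ^+ 2 == x)%:R = 1 + chi x.
Proof.
rewrite /chi; have [->|x0] := eqVneq.
  rewrite addr0 -[RHS](sum_delta (fun=> 1) 0).
  by apply: eq_bigr => y _; rewrite sqrf_eq0 mulr1.
case: existsP => [[z /eqP zx]|nx].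
  have zN : z != - z.
    rewrite -addr_eq0 -mulr2n -mulr_natl mulf_neq0 ?two_neq0 //.
    by apply: contraNneq x0 => z0; rewrite -zx z0 expr0n.
  rewrite (bigD1 z) //= zx eqxx (bigD1 (- z)) 1?eq_sym //= sqrrN zx eqxx.
  rewrite big1 ?addr0 // => y /andP[yz yNz].
  by rewrite -zx eqf_sqr (negbTE yz) (negbTE yNz).
rewrite subrr big1 // => y _; case: eqP => // yx.
by case: nx; exists y; rewrite yx.
Qed.

Lemma sum_sqr (f : F -> rat) : \sum_y f (y ^+ 2) = \sum_x (1 + chi x) * f x.
Proof.
under [RHS]eq_bigr do rewrite -card_sqrts mulr_suml.
rewrite exchange_big; apply: eq_bigr => y _ /=.
by under eq_bigr do rewrite eq_sym; rewrite sum_delta.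
Qed.

(** Counting each element as a square root of its square gives |F| = |F| + sum of chi. *)
Lemma sum_chi : \sum_x chi x = 0.
Proof.
have := sum_sqr (fun=> 1); under [RHS]eq_bigr do rewrite mulr1.
by rewrite big_split /= => /eqP; rewrite eq_sym -subr_eq0 addrAC subrr add0r => /eqP.
Qed.

Lemma sum_chiB (a : F) : \sum_x chi (a - x) = 0.
Proof. by rewrite -(reindex_inj (P := xpredT) (F := chi) (subrI a)) sum_chi. Qed.

Lemma sum1F : \sum_(x : F) 1 = #|F|%:R :> rat.
Proof. by rewrite sumr_const. Qed.

Lemma sum_chi2 (a b : F) :
  \sum_x chi (x - a) * chi (x - b) = #|F|%:R * (a == b)%:R - 1.
Proof.
have [->|ab] := eqVneq.
  under eq_bigr do rewrite -expr2 chi2E subr_eq0.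
  rewrite mulr1 -sum1F -[X in _ - X](sum_delta (fun=> 1) b) -sumrB.
  by apply: eq_bigr => x _; case: eqP => _ /=; rewrite ?mulr1 ?subr0 ?subrr.
rewrite (reindex_inj (addIr a)) /=.
pose c := b - a; have c0 : c != 0 by rewrite subr_eq0 eq_sym.
(* Since 0^-1 = 0, the term 1 - c / x takes the value 1 at x = 0; the delta corrects this. *)
have E x : chi (x + a - a) * chi (x + a - b) = chi (1 - c * x^-1) - (x == 0)%:R.
  rewrite addrK -chiM; have -> : x + a - b = x - c by rewrite /c; ring.
  have [->|x0] := eqVneq x 0; first by rewrite mul0r chi0 invr0 mulr0 subr0 chi1 subrr.
  have -> : x * (x - c) = x ^+ 2 * (1 - c * x^-1) by field.
  by rewrite chiM chi_sqr x0 mul1r subr0.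
rewrite (eq_bigr _ (fun x _ => E x)) sumrB.
rewrite mulr0 add0r (reindex_inj invr_inj) /=.
have -> : \sum_x chi (1 - c * x^-1^-1) = 0.
  under eq_bigr do rewrite invrK.
  by rewrite -(reindex_inj (P := xpredT) (F := fun x => chi (1 - x)) (mulfI c0)) sum_chiB.
rewrite sub0r (eq_bigr (fun x => (x == 0)%:R * 1)); last first.
  by move=> x _; rewrite mulr1.
by rewrite sum_delta.
Qed.

(** * A 2-isogeny identity for character sums of cubics *)

(** The equation y + b / y = v is quadratic in y with discriminant v^2 - 4 b, so it has 1 + chi(v^2
    - 4 b) solutions, none of them 0 as b != 0. *)
Lemma sum_addV (b : F) (f : F -> rat) : b != 0 ->
  \sum_(y | y != 0) f (y + b / y) = \sum_v (1 + chi (v ^+ 2 - 4 * b)) * f v.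
Proof.
move=> b0; have two0 := two_neq0.
under [RHS]eq_bigr do rewrite -card_sqrts mulr_suml.
have E v : \sum_(y : F) (y ^+ 2 == v ^+ 2 - 4 * b)%:R * f v =
    \sum_(y | y != 0) (v == y + b / y)%:R * f v.
  (* Completing the square: y is a root of y^2 - v y + b exactly when 2 y - v is a square root of
     the discriminant. *)
  pose h (y : F) := 2 * y - v.
  have hI : injective h by move=> y z /addIr /(mulfI two0).
  rewrite (reindex_inj hI) [RHS]big_mkcond; apply: eq_bigr => y _ /=.
  have -> : (h y ^+ 2 == v ^+ 2 - 4 * b) = (y ^+ 2 - v * y + b == 0).
    rewrite -subr_eq0 /h.
    have -> : (2 * y - v) ^+ 2 - (v ^+ 2 - 4 * b) = 2 * 2 * (y ^+ 2 - v * y + b).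
      by ring.
    by rewrite mulf_eq0 mulf_eq0 (negbTE two0).
  have [->|y0] /= := eqVneq y 0.
    by rewrite mulr0 expr0n subrr add0r (negbTE b0) mul0r.
  congr (_%:R * _); congr nat_of_bool; rewrite [v == _]eq_sym -[RHS]subr_eq0.
  have -> : y + b / y - v = (y ^+ 2 - v * y + b) / y by field.
  by rewrite mulf_eq0 invr_eq0 (negbTE y0) orbF.
rewrite (eq_bigr _ (fun v _ => E v)) exchange_big; apply: eq_bigr => y _ /=.
by rewrite sum_delta.
Qed.

(* The two curves are 2-isogenous; x |-> x + b / x + a carries the first sum to the second. *)
Lemma sum_chi_isogeny (a b : F) : b != 0 ->
  \sum_x chi (x * (x ^+ 2 + a * x + b)) =
  \sum_x chi (x * (x ^+ 2 - 2 * a * x + (a ^+ 2 - 4 * b))).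
Proof.
move=> b0; rewrite (bigID (fun x => x == 0)) /= big_pred1_eq mul0r chi0 add0r.
rewrite (eq_bigr (fun x => chi (x + b / x + a))); last first.
  move=> x x0.
  have -> : x * (x ^+ 2 + a * x + b) = x ^+ 2 * (x + b / x + a) by field.
  by rewrite chiM chi_sqr x0 mul1r.
rewrite (sum_addV (fun y => chi (y + a)) b0).
under [LHS]eq_bigr do rewrite mulrDl mul1r.
rewrite big_split /= -(reindex_inj (P := xpredT) (F := chi) (addIr a)) sum_chi add0r.
rewrite [RHS](reindex_inj (addIr a)); apply: eq_bigr => v _.
by rewrite -chiM /=; congr chi; ring.
Qed.

(** * Character sums of the Legendre curves *)

(** For l other than 0 and 1 this is minus the trace of Frobenius of y^2 = z (z - 1) (z - l). *)
Definition legendre_trace (l : F) : rat := \sum_z chi (z * (1 - z) * (l - z)).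
Local Notation tr := legendre_trace.

(** Take a = 1 + t^2 and b = t^2 in [sum_chi_isogeny]. Up to x -> -x the first cubic is the Legendre
    cubic with l = t^2. The second has the roots 0 and (1 +- t)^2, and dividing by (1 + t)^2 makes
    it the Legendre cubic with l = ((1 - t) / (1 + t))^2. *)
Lemma legendre_trace_landen (t : F) : t != 0 -> 1 + t != 0 ->
  tr (((1 - t) / (1 + t)) ^+ 2) = tr (t ^+ 2).
Proof.
move=> t0 t1; have t20 : t ^+ 2 != 0 by rewrite expf_neq0.
have := sum_chi_isogeny (1 + t ^+ 2) t20.
rewrite (reindex_inj oppr_inj) /= => e.
transitivity (\sum_x chi (- x * ((- x) ^+ 2 + (1 + t ^+ 2) * - x + t ^+ 2))).
  have u0 : (1 + t) ^+ 2 != 0 by rewrite expf_neq0.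
  rewrite e (reindex_inj (mulfI u0)); apply: eq_bigr => x _ /=.
  (* Scaling the variable of the cubic by (1 + t)^2 costs the factor (1 + t)^6, a nonzero square. *)
  rewrite -[LHS]mul1r -[LHS]mulr1 -[X in X * _ * _](_ : chi (((1 + t) ^+ 3) ^+ 2) = 1).
    by rewrite mulr1 -chiM; congr chi; field.
  by rewrite chi_sqr expf_neq0.
apply: eq_bigr => x _; rewrite -chiN; congr chi; ring.
Qed.

Lemma legendre_trace0 : tr 0 = -1.
Proof.
rewrite /tr (eq_bigr (fun z => chi (1 - z) - (z == 0)%:R * 1)); last first.
  move=> z _; rewrite sub0r mulrN chiN -mulrA mulrC -mulrA chiM -expr2 chi_sqr.
  by case: eqVneq => [->|_]; rewrite ?subr0 ?chi1 ?mulr0 ?mulr1 ?mul0r ?subrr ?subr0.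
by rewrite sumrB sum_chiB sum_delta sub0r.
Qed.

Lemma legendre_trace1 : tr 1 = -1.
Proof.
rewrite /tr (reindex_inj (subrI 1)) -legendre_trace0 /=.
apply: eq_bigr => z _ /=; rewrite -chiN; congr chi; ring.
Qed.

(** * The complete-graph sum and its relation to the curve y^2 = x^3 - x *)

(** The character product over the six edges of K4, with two of the vertices placed at 0 and 1. *)
Definition K4_sum : rat :=
  \sum_y \sum_z chi (y * z * (1 - y) * (1 - z) * (y - z)).

Lemma K4_sum_trace : K4_sum = \sum_y chi y * chi (1 - y) * tr y.
Proof.
apply: eq_bigr => y _; rewrite mulr_sumr; apply: eq_bigr => z _.
by rewrite -!chiM; congr chi; ring.
Qed.

(** Putting y = c^2 weights y by 1 + chi y. The chi part is [K4_sum]; the other part, summed over y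
    first, equals 1. *)
Lemma K4_sum_sqr : K4_sum = \sum_c chi (1 - c ^+ 2) * tr (c ^+ 2) - 1.
Proof.
rewrite (sum_sqr (fun y => chi (1 - y) * tr y)) K4_sum_trace.
under [X in _ = X - _]eq_bigr do rewrite mulrDl mul1r mulrA.
rewrite big_split /=.
suff -> : \sum_y chi (1 - y) * tr y = 1 by rewrite addrAC subrr add0r.
under eq_bigr do rewrite mulr_sumr.
rewrite exchange_big /= (eq_bigr (fun z => - (chi (z - 0) * chi (z - 1)))); last first.
  move=> z _; under eq_bigr do rewrite chiM mulrCA chiB.
  rewrite -mulr_sumr sum_chi2 eq_sym subr0 chiM (chiB 1).
  have [->|z1] := eqVneq z 1; first by rewrite subrr chi0 !mulr0 mul0r oppr0.
  by rewrite mulr0 sub0r mulrN1.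
by rewrite sumrN sum_chi2 eq_sym oner_eq0 mulr0 sub0r opprK.
Qed.

(** Writing the second variable as x t leaves an inner sum that depends on x^2 only. With weight 1 +
    chi and after inversion of x^2, it splits into [tr (t ^+ 2)] and a quadratic sum. The latter
    adds the order of F at t = 1 and t = -1; the remaining constant -2 disappears because chi sums
    to 0. *)
Lemma sum_cube_sqr :
  (\sum_x chi (x ^+ 3 - x)) ^+ 2 = \sum_t chi t * tr (t ^+ 2) + 2 * #|F|%:R.
Proof.
rewrite expr2 mulr_suml.
under eq_bigr do rewrite mulr_sumr.
transitivity (\sum_(x | x != 0) \sum_t
    chi t * chi ((x ^+ 2 - 1) * (x ^+ 2 * t ^+ 2 - 1))).
  rewrite [RHS]big_mkcond; apply: eq_bigr => x _ /=.
  have [->|x0] := eqVneq x 0.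
    by rewrite big1 // => t _; rewrite expr0n subr0 chi0 mul0r.
  rewrite (reindex_inj (mulfI x0)); apply: eq_bigr => t _ /=.
  rewrite -!chiM.
  have -> : (x ^+ 3 - x) * ((x * t) ^+ 3 - x * t) =
    x ^+ 2 * (t * ((x ^+ 2 - 1) * (x ^+ 2 * t ^+ 2 - 1))) by ring.
  by rewrite [LHS]chiM chi_sqr x0 mul1r.
rewrite exchange_big /=.
have E (t : F) : t != 0 -> \sum_(x | x != 0) chi ((x ^+ 2 - 1) * (x ^+ 2 * t ^+ 2 - 1))
   = tr (t ^+ 2) + #|F|%:R * (1 == t ^+ 2)%:R - 2.
  move=> t0.
  (* The factor [e != 0] discards x = 0. After inversion it discards z = 0, whose missing term
     chi(t^2) = 1 accounts for half of the -2. *)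
  pose f (e : F) := (e != 0)%:R * chi ((1 - e^-1) * (t ^+ 2 - e^-1)).
  transitivity (\sum_x f (x ^+ 2)).
    rewrite big_mkcond; apply: eq_bigr => x _; rewrite /f sqrf_eq0.
    case: eqVneq => [|x0] /=; first by rewrite mul0r.
    have -> : (x ^+ 2 - 1) * (x ^+ 2 * t ^+ 2 - 1) =
      (x ^+ 2) ^+ 2 * ((1 - (x ^+ 2)^-1) * (t ^+ 2 - (x ^+ 2)^-1)) by field.
    by rewrite chiM chi_sqr expf_neq0.
  rewrite sum_sqr (reindex_inj invr_inj) /=.
  under eq_bigr do rewrite mulrDl mul1r.
  rewrite big_split /= [LHS]addrC -[RHS]addrA; congr (_ + _).
    apply: eq_bigr => z _; rewrite /f invrK invr_eq0 -mulrA (chiM z) chiV.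
    by case: eqVneq => [->|_]; rewrite ?chi0 ?mul0r ?mul1r.
  rewrite (eq_bigr (fun z => chi (z - 1) * chi (z - t ^+ 2) - (z == 0)%:R * 1)).
    by rewrite sumrB sum_chi2 sum_delta -addrA -opprD.
  move=> z _; rewrite /f invrK invr_eq0 chiM (chiB 1) (chiB _ z).
  case: eqVneq => [->|_]; last by rewrite mul0r subr0 mul1r.
  by rewrite !sub0r !chiN chi1 chi_sqr t0 mul0r !mul1r subrr.
rewrite (eq_bigr (fun t => chi t * tr (t ^+ 2) - 2 * chi t
      + ((t == 1)%:R * #|F|%:R + (t == -1)%:R * #|F|%:R))); last first.
  move=> t _; rewrite -mulr_sumr.
  have [->|t0] := eqVneq t 0.
    by rewrite chi0 ![0 == _]eq_sym oppr_eq0 oner_eq0 /= !mul0r mulr0; ring.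
  rewrite E // [1 == _]eq_sym sqrf_eq1.
  have n1 : 1 == -1 :> F = false.
    by apply/negbTE; rewrite -addr_eq0 two_neq0.
  have [->|t1] := eqVneq t 1; first by rewrite n1 chi1 /=; ring.
  have [->|tN1] := eqVneq t (-1); first by rewrite chiN chi1 /=; ring.
  by rewrite /=; ring.
rewrite !big_split /= sumrN -mulr_sumr sum_chi mulr0 subr0.
by rewrite !(sum_delta (fun=> _)) -mulr2n mulr_natl.
Qed.

Theorem K4_sumE : K4_sum = (\sum_x chi (x ^+ 3 - x)) ^+ 2 - 2 * #|F|%:R.
Proof.
rewrite sum_cube_sqr addrK K4_sum_sqr; have two0 := two_neq0.
have trN1 : tr ((-1) ^+ 2) = -1 by rewrite sqrrN expr1n legendre_trace1.
(* The point -1, where (1 - t) / (1 + t) has a pole, is split off. Its term is 0 on the left; on the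
   right it is chi(-1) [tr 1] = -1, matching the constant in [K4_sum_sqr]. *)
rewrite (bigD1 (-1)) //= [in RHS](bigD1 (-1)) //= trN1 chiN chi1 mul1r.
rewrite sqrrN expr1n subrr chi0 mul0r add0r [RHS]addrC; congr (_ - _).
pose h (t : F) := (1 - t) / (1 + t).
have neqN1 (t : F) : t != -1 -> 1 + t != 0 by rewrite addrC addr_eq0.
have hK (t : F) : t != -1 -> h (h t) = t.
  move=> /neqN1 t1; rewrite /h; field; rewrite t1 /=.
  by rewrite (_ : _ + _ = 2); [|ring].
rewrite (reindex_onto h h) //; apply: eq_big => [t|t /andP[ht /eqP hht]].
  (* With 0^-1 = 0 one gets h(-1) = 0 and h(0) = 1, so -1 fails h (h t) = t and is excluded by the
     reindexing. *)
  apply/andP/idP => [[_ /eqP e]|t1].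
    apply: contra_eq_neq e => ->; rewrite /h subrr invr0 mulr0 subr0 addr0 divr1.
    by rewrite -addr_eq0.
  rewrite hK // eqxx; split=> //; rewrite -addr_eq0 /h.
  rewrite (_ : _ + 1 = 2 / (1 + t)); last by field; exact: neqN1.
  by rewrite mulf_neq0 // invr_neq0 // neqN1.
have [->|t0] := eqVneq t 0.
  by rewrite /h subr0 addr0 divr1 expr1n subrr chi0 !mul0r.
have t1 : 1 + t != 0.
  apply: contraNneq ht => t1; move: hht; rewrite /h t1 invr0 mulr0 subr0 addr0 divr1 => e.
  by move: two0; rewrite -[2]/(1 + 1) {2}e t1 eqxx.
rewrite legendre_trace_landen //; congr (_ * _).
have -> : 1 - h t ^+ 2 = (2 / (1 + t)) ^+ 2 * t by rewrite /h; field.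
by rewrite chiM chi_sqr mulf_neq0 ?invr_neq0 // mul1r.
Qed.
End QuadraticCharacter.

(** * Labelled graphs on four vertices up to relabelling *)

(* A graph on {0,1,2,3}, as the 6-tuple of its adjacencies 01, 02, 03, 12, 13, 23. *)
Definition edges6 : finType := (bool * bool * bool * bool * bool * bool)%type.

(** The three swaps relabel by the adjacent transpositions, which generate all permutations. *)
Definition swap01 (s : edges6) : edges6 :=
  let: (s01, s02, s03, s12, s13, s23) := s in (s01, s12, s13, s02, s03, s23).
Definition swap12 (s : edges6) : edges6 :=
  let: (s01, s02, s03, s12, s13, s23) := s in (s02, s01, s03, s12, s23, s13).
Definition swap23 (s : edges6) : edges6 :=
  let: (s01, s02, s03, s12, s13, s23) := s in (s01, s03, s02, s13, s12, s23).

Definition odd_edges (s : edges6) : bool :=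
  let: (s01, s02, s03, s12, s13, s23) := s in
  s01 (+) s02 (+) s03 (+) s12 (+) s13 (+) s23.

(* [q] stands for the order of the field and [t] for the value of [K4_sum]. *)
Definition edge_sum_val (R : comNzRingType) (q t : R) (s : edges6) : R :=
  let: (s01, s02, s03, s12, s13, s23) := s in
  let opposite_equal := [&& s01 == s23, s02 == s13 & s03 == s12] in
  match (s01 + s02 + s03 + s12 + s13 + s23)%N with
  | 0 => (q - 1) * (q - 2) * (q - 3)
  | 2 => if opposite_equal then 2 * (q - 1) else - (q - 1) * (q - 3)
  | 4 => if opposite_equal then (q - 1) * (3 - q) else 2 * (q - 1)
  | 6 => (q - 1) * t
  | _ => 0
  end.

Lemma rmorph_edge_sum_val (R R' : comNzRingType) (f : {rmorphism R -> R'}) q t s :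
  f (edge_sum_val q t s) = edge_sum_val (f q) (f t) s.
Proof.
by case: s => [[[[[[] []] []] []] []] []] /=;
  rewrite ?(rmorphM, rmorphB, rmorphN, rmorph_nat, rmorph1, rmorph0).
Qed.

(** Up to relabelling, the graphs with an even number of edges are, in the order listed, the empty
    graph, the cherry, 2K2, C4, the paw and K4. *)
Lemma edges6_ind (P : edges6 -> Prop) :
  (forall s, P (swap01 s) -> P s) -> (forall s, P (swap12 s) -> P s) ->
  (forall s, P (swap23 s) -> P s) ->
  (forall s, odd_edges s -> P s) ->
  P (false, false, false, false, false, false) ->
  P (true, true, false, false, false, false) ->
  P (true, false, false, false, false, true) ->
  P (false, true, true, true, true, false) ->
  P (true, true, true, true, false, false) ->
  P (true, true, true, true, true, true) ->
  forall s, P s.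
Proof.
move=> s01 s12 s23 odd_P P0 P3 P22 P4 Ppaw P6 s.
pose canon (s : edges6) := odd_edges s || (s \in
  [:: (false, false, false, false, false, false);
  (true, true, false, false, false, false);
  (true, false, false, false, false, true);
  (false, true, true, true, true, false);
  (true, true, true, true, false, false);
  (true, true, true, true, true, true)]).
have canonP r : canon r -> P r.
  case/orP; first exact: odd_P.
  by rewrite !inE => /or4P[| | |/or3P[| |]] /eqP->.
(* Coset representatives along S_2 < S_3 < S_4: the 2, 3 and 4 choices compose to all 24
   relabellings, and the 64 graphs are then checked by computation. *)
pose f := fun s => [:: s; swap01 s].
pose g := fun s => [:: s; swap12 s; swap12 (swap01 s)].
pose h := fun s => [:: s; swap23 s; swap23 (swap12 s); swap23 (swap12 (swap01 s))].
have fP r : has canon (f r) -> P r.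
  by case/or3P=> // /canonP; last move=> ?; auto.
have gP r : has (has canon \o f) (g r) -> P r.
  by case/or4P=> //= /fP; auto.
have hP r : has (has (has canon \o f) \o g) (h r) -> P r.
  by case/or4P=> /= [| | |/orP[|//]] /gP; auto 6.
by apply: hP; case: s => [[[[[[] []] []] []] []] []]; vm_compute.
Qed.

(** * Character sums over four distinct points, one for each graph *)

Section EdgeSums.
Variables (F : finFieldType) (k : nat).
Hypothesis cardF : #|F| = (4 * k + 1)%N.
Local Notation q := (#|F|%:R : rat).

Definition chi_pow (b : bool) (x : F) : rat := if b then chi x else chi x ^+ 2.
Local Notation w := chi_pow.

Definition edge_prod (s : edges6) (a b c d : F) : rat :=
  let: (s01, s02, s03, s12, s13, s23) := s in
  w s01 (a - b) * w s02 (a - c) * w s03 (a - d) * w s12 (b - c) * w s13 (b - d)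
  * w s23 (c - d).

(* The exponent 2 on the non-edges makes the sum range over pairwise distinct a, b, c, d. *)
Definition edge_sum (s : edges6) : rat :=
  \sum_a \sum_b \sum_c \sum_d edge_prod s a b c d.

Lemma chi_powB e x y : w e (x - y) = w e (y - x).
Proof. by rewrite /w (chiB cardF). Qed.

Lemma edge_sum_swap01 s : edge_sum (swap01 s) = edge_sum s.
Proof.
case: s => [[[[[s01 s02] s03] s12] s13] s23]; rewrite /edge_sum exchange_big.
apply: eq_bigr => a _; apply: eq_bigr => b _; apply: eq_bigr => c _.
apply: eq_bigr => d _ /=; rewrite (chi_powB s01); ring.
Qed.

Lemma edge_sum_swap12 s : edge_sum (swap12 s) = edge_sum s.
Proof.
case: s => [[[[[s01 s02] s03] s12] s13] s23]; rewrite /edge_sum.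
apply: eq_bigr => a _; rewrite exchange_big.
apply: eq_bigr => b _; apply: eq_bigr => c _.
apply: eq_bigr => d _ /=; rewrite (chi_powB s12); ring.
Qed.

Lemma edge_sum_swap23 s : edge_sum (swap23 s) = edge_sum s.
Proof.
case: s => [[[[[s01 s02] s03] s12] s13] s23]; rewrite /edge_sum.
apply: eq_bigr => a _; apply: eq_bigr => b _; rewrite exchange_big.
apply: eq_bigr => c _; apply: eq_bigr => d _ /=; rewrite (chi_powB s23); ring.
Qed.

Lemma exists_nonresidue : exists2 n : F, n != 0 & chi n = -1.
Proof.
case: (pickP (fun n : F => (n != 0) && (chi n == -1))) => [n /andP[n0 /eqP]|H].
  by exists n.
suff : \sum_(x : F) chi x != 0 by rewrite (sum_chi cardF) eqxx.
rewrite psumr_neq0 //=.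
  by apply/hasP; exists 1; rewrite ?mem_index_enum // (chi1 cardF) ltr01.
move=> x _; have := H x; rewrite /chi.
by case: eqVneq => //= _; case: ifP; rewrite ?eqxx.
Qed.

Lemma edge_sum_odd s : odd_edges s -> edge_sum s = 0.
Proof.
move=> s_odd; have [n n0 nN1] := exists_nonresidue.
have : edge_sum s = - edge_sum s.
  have scale (f : F -> rat) : \sum_x f x = \sum_x f (n * x).
    by rewrite (reindex_inj (mulfI n0)).
  rewrite {1}/edge_sum scale -sumrN; apply: eq_bigr => a _.
  rewrite scale -sumrN; apply: eq_bigr => b _.
  rewrite scale -sumrN; apply: eq_bigr => c _.
  rewrite scale -sumrN; apply: eq_bigr => d _.
  case: s s_odd => [[[[[s01 s02] s03] s12] s13] s23] s_odd /=.
  have wn e x y : w e (n * x - n * y) = (-1) ^+ e * w e (x - y).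
    by rewrite -mulrBr /w; case: e; rewrite (chiM cardF) nN1 ?exprMn ?sqrrN ?expr1n.
  rewrite !wn.
  move: s_odd; case: s01; case: s02; case: s03; case: s12; case: s13; case: s23 => //= _;
    rewrite ?expr0 ?expr1; ring.
lra.
Qed.

(** * Summation over one vertex that avoids the others *)

Lemma chi_pow0 e : w e 0 = 0.
Proof. by case: e; rewrite /w chi0 // expr0n. Qed.

Lemma chi_powF x : w false x = 1 - (x == 0)%:R.
Proof. by rewrite /w chi2E; case: eqP => _; rewrite ?subr0 ?subrr. Qed.

Lemma sum_deltaB (f : F -> rat) (a : F) : \sum_x (a - x == 0)%:R * f x = f a.
Proof. by rewrite -[RHS](sum_delta f); apply: eq_bigr => x _; rewrite subr_eq0 eq_sym. Qed.

Lemma sum_neq1 (f : F -> rat) c : \sum_d f d * w false (c - d) = \sum_d f d - f c.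
Proof.
under eq_bigr do rewrite chi_powF mulrBr mulr1.
by rewrite sumrB; under [X in _ - X]eq_bigr do rewrite mulrC; rewrite sum_deltaB.
Qed.

Lemma sum_neq2 (f : F -> rat) b c : b != c ->
  \sum_d f d * w false (b - d) * w false (c - d) = \sum_d f d - f b - f c.
Proof.
move=> bc; rewrite (sum_neq1 (fun d => f d * _)) sum_neq1 chi_powF subr_eq0.
by rewrite (negbTE bc) subr0 mulr1.
Qed.

Lemma sum_neq3 (a b c : F) : a != b -> a != c -> b != c ->
  \sum_d w false (a - d) * w false (b - d) * w false (c - d) = q - 3.
Proof.
move=> ab ac bc; rewrite (sum_neq2 (fun d => w false (a - d))) //.
under eq_bigr do rewrite -[w _ _]mul1r.
rewrite (sum_neq1 (fun=> 1)) sum1F !chi_powF !subr_eq0 (negbTE ab) (negbTE ac) /=.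
by ring.
Qed.

Lemma sum_chi_neq2 (a b c : F) : b != c ->
  \sum_d chi (a - d) * w false (b - d) * w false (c - d) = - chi (a - b) - chi (a - c).
Proof.
by move=> bc; rewrite (sum_neq2 (fun d => chi (a - d))) // (sum_chiB cardF) sub0r.
Qed.

Lemma sum_chi2_neq1 (a b c : F) : a != b ->
  \sum_d chi (a - d) * chi (b - d) * w false (c - d) = -1 - chi (a - c) * chi (b - c).
Proof.
move=> ab; rewrite (sum_neq1 (fun d => chi (a - d) * chi (b - d))); congr (_ - _).
under eq_bigr do rewrite (chiB cardF a) (chiB cardF b).
by rewrite (sum_chi2 cardF) (negbTE ab) mulr0 sub0r.
Qed.

Lemma sum_cst (x : rat) : \sum_(a : F) x = q * x.
Proof. by rewrite sumr_const mulr_natl. Qed.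

Lemma sum_triples :
  \sum_(a : F) \sum_b \sum_c w false (a - b) * w false (a - c) * w false (b - c)
  = q * (q - 1) * (q - 2).
Proof.
have E (a b : F) : \sum_c w false (a - b) * w false (a - c) * w false (b - c)
    = (q - 2) * w false (a - b).
  have [->|ab] := eqVneq a b.
    by rewrite subrr chi_pow0 mulr0 big1 // => c _; rewrite !mul0r.
  by rewrite (sum_neq2 (fun=> _)) // sum_cst chi_powF subr_eq0 (negbTE ab); ring.
under eq_bigr do under eq_bigr do rewrite E.
under eq_bigr do rewrite (sum_neq1 (fun=> _)) sum_cst.
by rewrite sum_cst; ring.
Qed.

(** The sum of chi(a - c) over c != b is -chi(a - b), so each pair of distinct a, b contributes
    -1. *)
Lemma sum_cherries :
  \sum_(a : F) \sum_b \sum_c chi (a - b) * chi (a - c) * w false (b - c)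
  = - (q * (q - 1)).
Proof.
have E (a b : F) : \sum_c chi (a - b) * chi (a - c) * w false (b - c)
    = - (1 * w false (a - b)).
  rewrite (sum_neq1 (fun c => _ * chi (a - c))) -mulr_sumr (sum_chiB cardF).
  by rewrite mulr0 sub0r mul1r -expr2.
under eq_bigr do under eq_bigr do rewrite E.
under eq_bigr do rewrite sumrN (sum_neq1 (fun=> _)) sum_cst.
by rewrite sumrN sum_cst; ring.
Qed.

Lemma eq_sum3 (f g : F -> F -> F -> rat) :
  (forall a b c, a != b -> a != c -> b != c -> f a b c = g a b c) ->
  (forall a b c, [|| a == b, a == c | b == c] -> f a b c = 0 /\ g a b c = 0) ->
  \sum_a \sum_b \sum_c f a b c = \sum_a \sum_b \sum_c g a b c.
Proof.
move=> fg fg0; apply: eq_bigr => a _; apply: eq_bigr => b _; apply: eq_bigr => c _.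
have [abc|] := boolP [|| a == b, a == c | b == c].
  by have [-> ->] := fg0 a b c abc.
by rewrite !negb_or => /and3P[]; exact: fg.
Qed.

Lemma edge_sum_collision s (a b c d : F) :
  [|| a == b, a == c | b == c] -> edge_prod s a b c d = 0.
Proof.
case: s => [[[[[s01 s02] s03] s12] s13] s23] /or3P[]/eqP-> /=.
all: by rewrite subrr chi_pow0 ?(mulr0, mul0r).
Qed.

(** The factors in a, b, c vanish at any coincidence, so the sum over d need only be known for
    distinct a, b, c. *)
Lemma edge_sum_last s (g : F -> F -> F -> rat) :
  (forall a b c, a != b -> a != c -> b != c ->
     \sum_d edge_prod s a b c d =
     let: (s01, s02, s03, s12, s13, s23) := s in
     w s01 (a - b) * w s02 (a - c) * w s12 (b - c) * g a b c) ->
  edge_sum s = \sum_a \sum_b \sum_c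
     let: (s01, s02, s03, s12, s13, s23) := s in
     w s01 (a - b) * w s02 (a - c) * w s12 (b - c) * g a b c.
Proof.
move=> H; apply: eq_sum3 => // a b c abc; split.
  by rewrite big1 // => d _; rewrite edge_sum_collision.
case: s H => [[[[[s01 s02] s03] s12] s13] s23] _.
by case/or3P: abc => /eqP->; rewrite subrr chi_pow0 ?(mulr0, mul0r).
Qed.

Lemma edge_sum_empty :
  edge_sum (false, false, false, false, false, false) = q * (q - 1) * (q - 2) * (q - 3).
Proof.
rewrite (edge_sum_last (g := fun _ _ _ => q - 3)); last first.
  move=> a b c ab ac bc; rewrite -(sum_neq3 ab ac bc) mulr_sumr.
  by apply: eq_bigr => d _ /=; ring.
rewrite -sum_triples mulr_suml; apply: eq_bigr => a _.
rewrite mulr_suml; apply: eq_bigr => b _; rewrite mulr_suml; exact: eq_bigr.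
Qed.

Lemma edge_sum_cherry :
  edge_sum (true, true, false, false, false, false) = - (q * (q - 1)) * (q - 3).
Proof.
rewrite (edge_sum_last (g := fun _ _ _ => q - 3)); last first.
  move=> a b c ab ac bc; rewrite -(sum_neq3 ab ac bc) mulr_sumr.
  by apply: eq_bigr => d _ /=; ring.
rewrite -sum_cherries mulr_suml; apply: eq_bigr => a _.
rewrite mulr_suml; apply: eq_bigr => b _; rewrite mulr_suml; exact: eq_bigr.
Qed.

Lemma sum_cherries1 :
  \sum_(a : F) \sum_b \sum_c chi (a - b) * w false (a - c) * chi (b - c)
  = - (q * (q - 1)).
Proof.
rewrite -sum_cherries exchange_big; apply: eq_bigr => a _; apply: eq_bigr => b _.
by apply: eq_bigr => c _; rewrite (chiB cardF b a); ring.
Qed.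

Lemma sum_cherries2 :
  \sum_(a : F) \sum_b \sum_c w false (a - b) * chi (a - c) * chi (b - c)
  = - (q * (q - 1)).
Proof.
rewrite -sum_cherries1; apply: eq_bigr => a _; rewrite exchange_big.
apply: eq_bigr => b _; apply: eq_bigr => c _.
by rewrite (chiB cardF c b); ring.
Qed.

Lemma sum3_sub (f g h : F -> F -> F -> rat) :
  (forall a b c, f a b c = - g a b c - h a b c) ->
  \sum_a \sum_b \sum_c f a b c =
  - (\sum_a \sum_b \sum_c g a b c) - \sum_a \sum_b \sum_c h a b c.
Proof.
move=> fgh; rewrite -!sumrN -big_split; apply: eq_bigr => a _.
rewrite -!sumrN -big_split; apply: eq_bigr => b _.
by rewrite -!sumrN -big_split; apply: eq_bigr.
Qed.

(** Summing chi(c - d) over d distinct from a and b leaves -chi(c - a) - chi(c - b); together with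
    the edge a b, each term is a cherry. *)
Lemma edge_sum_2K2 :
  edge_sum (true, false, false, false, false, true) = 2 * (q * (q - 1)).
Proof.
rewrite (edge_sum_last (g := fun a b c => - chi (c - a) - chi (c - b))); last first.
  move=> a b c ab ac bc; rewrite -(sum_chi_neq2 _ ab) mulr_sumr.
  by apply: eq_bigr => d _ /=; ring.
rewrite (sum3_sub (g := fun a b c => chi (a - b) * chi (a - c) * w false (b - c))
  (h := fun a b c => chi (a - b) * w false (a - c) * chi (b - c))).
  by rewrite sum_cherries sum_cherries1; ring.
move=> a b c; rewrite (chiB cardF c a) (chiB cardF c b) !chi_powF /=.
have [->|ac] := eqVneq a c; first by rewrite subrr eqxx chi0 /=; ring.
have [->|bc] := eqVneq b c; first by rewrite subrr eqxx chi0 /=; ring.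
by rewrite !subr_eq0 (negbTE ac) (negbTE bc) /=; ring.
Qed.

(** Summing over the common neighbour d of a and b leaves -1 - chi(a - c) chi(b - c): a cherry sum,
    and a count of distinct triples because the characters get squared. *)
Lemma edge_sum_C4 :
  edge_sum (false, true, true, true, true, false) = q * (q - 1) * (3 - q).
Proof.
rewrite (edge_sum_last (g := fun a b c => -1 - chi (a - c) * chi (b - c))); last first.
  move=> a b c ab ac bc; rewrite -(sum_chi2_neq1 _ ab) mulr_sumr.
  by apply: eq_bigr => d _ /=; ring.
rewrite (sum3_sub (g := fun a b c => w false (a - b) * chi (a - c) * chi (b - c))
  (h := fun a b c => w false (a - b) * w false (a - c) * w false (b - c))).
  by rewrite sum_cherries2 sum_triples; ring.
by move=> a b c /=; ring.
Qed.

(** Summing over the pendant vertex d leaves -chi(a - b) - chi(a - c); each term squares one edge of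
    the triangle and turns it into a cherry. *)
Lemma edge_sum_paw :
  edge_sum (true, true, true, true, false, false) = 2 * (q * (q - 1)).
Proof.
rewrite (edge_sum_last (g := fun a b c => - chi (a - b) - chi (a - c))); last first.
  move=> a b c ab ac bc; rewrite -(sum_chi_neq2 _ bc) mulr_sumr.
  by apply: eq_bigr => d _ /=; ring.
rewrite (sum3_sub (g := fun a b c => w false (a - b) * chi (a - c) * chi (b - c))
  (h := fun a b c => chi (a - b) * w false (a - c) * chi (b - c))).
  by rewrite sum_cherries2 sum_cherries1; ring.
by move=> a b c /=; ring.
Qed.

(** An affine map carries 0, 1 to any of the q (q - 1) pairs of distinct first vertices. It scales
    the six differences by b^6 in all, a square. *)
Lemma edge_sum_K4 :
  edge_sum (true, true, true, true, true, true) = q * (q - 1) * K4_sum F.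
Proof.
have -> : q * (q - 1) * K4_sum F =
    \sum_(a : F) \sum_b 1 * w false (0 - b) * K4_sum F.
  under [RHS]eq_bigr do rewrite -mulr_suml (sum_neq1 (fun=> 1)) sum1F.
  by rewrite sum_cst; ring.
apply: eq_bigr => a _; rewrite (reindex_inj (addrI a)); apply: eq_bigr => b _.
have [->|b0] := eqVneq b 0.
  rewrite subrr chi_pow0 mulr0 mul0r big1 // => c _; rewrite big1 // => d _.
  by rewrite /edge_prod addr0 subrr chi_pow0 !mul0r.
rewrite sub0r mul1r chi_powF oppr_eq0 (negbTE b0) subr0 mul1r.
have affI : injective (fun c => a + b * c) by move=> c d /addrI /(mulfI b0).
rewrite (reindex_inj affI); apply: eq_bigr => c _.
rewrite (reindex_inj affI); apply: eq_bigr => d _ /=; rewrite /w -!(chiM cardF).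
have -> : (a - (a + b)) * (a - (a + b * c)) * (a - (a + b * d))
    * (a + b - (a + b * c)) * (a + b - (a + b * d)) * (a + b * c - (a + b * d))
  = (b ^+ 3) ^+ 2 * - (c * d * (1 - c) * (1 - d) * (c - d)) by ring.
by rewrite (chiM cardF) (chi_sqr cardF) expf_neq0 // mul1r (chiN cardF).
Qed.

(** Both sides are invariant under relabelling, which leaves the representatives of [edges6_ind]. In
    [edge_sum_val], [opposite_equal] separates 2K2 from the cherry and C4 from the paw. *)
Theorem edge_sumE s : edge_sum s = q * edge_sum_val q (K4_sum F) s.
Proof.
elim/edges6_ind: s => [s|s|s|s s_odd|||||| ].
- rewrite edge_sum_swap01 => ->; congr (_ * _).
  by case: s => [[[[[[] []] []] []] []] []].
- rewrite edge_sum_swap12 => ->; congr (_ * _).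
  by case: s => [[[[[[] []] []] []] []] []].
- rewrite edge_sum_swap23 => ->; congr (_ * _).
  by case: s => [[[[[[] []] []] []] []] []].
- rewrite edge_sum_odd //; case: s s_odd => [[[[[[] []] []] []] []] []] //= _;
  by rewrite mulr0.
- by rewrite edge_sum_empty /=; ring.
- by rewrite edge_sum_cherry /=; ring.
- by rewrite edge_sum_2K2 /=; ring.
- by rewrite edge_sum_C4 /=; ring.
- by rewrite edge_sum_paw /=; ring.
- by rewrite edge_sum_K4 /=; ring.
Qed.

(** * Adjacency patterns expanded into character sums *)

(** This is (chi^2 + chi) / 2 or (chi^2 - chi) / 2, written as a sum over [s] so that a product over
    the six pairs expands into a sum over graphs. *)
Definition chi_sgn (b : bool) (x : F) : rat :=
  \sum_(s : bool) (-1) ^+ (~~ b && s) / 2 * w s x.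

Lemma chi_sgnE b x : chi_sgn b x = ((x != 0) && ([exists y : F, y ^+ 2 == x] == b))%:R.
Proof.
rewrite /chi_sgn big_bool /= andbT andbF /w /chi; case: eqVneq => _ /=.
  by rewrite expr0n !mulr0 addr0.
by case: existsP => _; case: b => /=; rewrite ?expr0 ?expr1 ?sqrrN ?expr1n //; field.
Qed.

Definition pattern_prod (b : edges6) (x y z t : F) : rat :=
  let: (b01, b02, b03, b12, b13, b23) := b in
  chi_sgn b01 (x - y) * chi_sgn b02 (x - z) * chi_sgn b03 (x - t)
  * chi_sgn b12 (y - z) * chi_sgn b13 (y - t) * chi_sgn b23 (z - t).

Definition edge_sgn (b s : edges6) : rat :=
  let: (b01, b02, b03, b12, b13, b23) := b in
  let: (s01, s02, s03, s12, s13, s23) := s in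
  (-1) ^+ (~~ b01 && s01) * (-1) ^+ (~~ b02 && s02) * (-1) ^+ (~~ b03 && s03)
  * (-1) ^+ (~~ b12 && s12) * (-1) ^+ (~~ b13 && s13) * (-1) ^+ (~~ b23 && s23).

Lemma pattern_prodE b x y z t :
  pattern_prod b x y z t = \sum_s edge_sgn b s / 64 * edge_prod s x y z t.
Proof.
case: b => [[[[[b01 b02] b03] b12] b13] b23]; rewrite /pattern_prod /chi_sgn.
do 5 rewrite big_distrlr /= pair_bigA /=.
by apply: eq_bigr => -[[[[[s01 s02] s03] s12] s13] s23] _ /=; field.
Qed.

Lemma sum_pattern_prod b :
  \sum_x \sum_y \sum_z \sum_t pattern_prod b x y z t =
  q * \sum_s edge_sgn b s / 64 * edge_sum_val q (K4_sum F) s.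
Proof.
rewrite mulr_sumr.
under [RHS]eq_bigr do rewrite mulrCA -edge_sumE mulr_sumr.
rewrite [RHS]exchange_big; apply: eq_bigr => x _ /=.
under [RHS]eq_bigr do rewrite mulr_sumr.
rewrite [RHS]exchange_big; apply: eq_bigr => y _ /=.
under [RHS]eq_bigr do rewrite mulr_sumr.
rewrite [RHS]exchange_big; apply: eq_bigr => z _ /=.
under [RHS]eq_bigr do rewrite mulr_sumr.
rewrite [RHS]exchange_big; apply: eq_bigr => t _ /=.
exact: pattern_prodE.
Qed.

End EdgeSums.

Lemma sum_edges6 (f : edges6 -> rat) : \sum_s f s =
  \sum_s01 \sum_s02 \sum_s03 \sum_s12 \sum_s13 \sum_s23 f (s01, s02, s03, s12, s13, s23).
Proof. by rewrite !pair_bigA; apply: eq_bigr => -[[[[[? ?] ?] ?] ?] ?]. Qed.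

(** For the complete pattern all signs are 1; the contributions come from the empty graph, 12
    cherries, 3 copies of 2K2, 3 of C4, 12 paws and K4. *)
Lemma sum_edge_sum_val (q t : rat) :
  \sum_s edge_sgn (true, true, true, true, true, true) s / 64 * edge_sum_val q t s
  = (q - 1) * (q ^+ 2 - 20 * q + 81 + t) / 64.
Proof.
by rewrite sum_edges6 !big_bool /= !expr0; field.
Qed.

(** * Four-tuples and adjacency matrices *)

Definition i0 : 'I_4 := Ordinal (isT : 0 < 4)%N.
Definition i1 : 'I_4 := Ordinal (isT : 1 < 4)%N.
Definition i2 : 'I_4 := Ordinal (isT : 2 < 4)%N.
Definition i3 : 'I_4 := Ordinal (isT : 3 < 4)%N.

Lemma forall_ord4 (P : 'I_4 -> Prop) : P i0 -> P i1 -> P i2 -> P i3 -> forall i, P i.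
Proof.
move=> P0 P1 P2 P3 [[|[|[|[|//]]]] lt_i4].
- by rewrite (_ : Ordinal _ = i0) //; apply: val_inj.
- by rewrite (_ : Ordinal _ = i1) //; apply: val_inj.
- by rewrite (_ : Ordinal _ = i2) //; apply: val_inj.
- by rewrite (_ : Ordinal _ = i3) //; apply: val_inj.
Qed.

Lemma sum_ffun4 (T : finType) (f : T -> T -> T -> T -> rat) :
  \sum_(A : {ffun 'I_4 -> T}) f (A i0) (A i1) (A i2) (A i3) =
  \sum_x \sum_y \sum_z \sum_t f x y z t.
Proof.
rewrite !pair_bigA /=.
(* The fourth entry is the default value of [nth]. *)
pose h (u : T * T * T * T) : {ffun 'I_4 -> T} :=
  [ffun i : 'I_4 => nth u.2 [:: u.1.1.1; u.1.1.2; u.1.2] i].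
rewrite (reindex_onto h (fun A => (A i0, A i1, A i2, A i3))) /=.
  apply: eq_big => [[[[x y] z] t]|[[[x y] z] t] _]; rewrite !ffunE //= eqxx.
  by [].
by move=> A _; apply/ffunP; elim/forall_ord4; rewrite ffunE.
Qed.

Definition edges6_graph (b : edges6) : rel 'I_4 :=
  let: (b01, b02, b03, b12, b13, b23) := b in fun i j =>
  nth false (nth [::] [:: [:: false; b01; b02; b03]; [:: b01; false; b12; b13];
     [:: b02; b12; false; b23]; [:: b03; b13; b23; false]] i) j.

Lemma eq_graph_iso l (e e' f : rel 'I_l) : e =2 e' -> graph_iso e f = graph_iso e' f.
Proof.
move=> ee'; apply: eq_existsb => s; apply: eq_forallb => i; apply: eq_forallb => j.
by rewrite ee'.
Qed.

Lemma graph_iso_K4 b :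
  graph_iso (edges6_graph b) K4 = (b == (true, true, true, true, true, true)).
Proof.
apply/existsP/eqP => [[s /'forall_forallP H]|->]; last first.
  exists 1%g; apply/forallP; elim/forall_ord4; apply/forallP; elim/forall_ord4;
    by rewrite /K4 !perm1.
have E i j : edges6_graph b i j = (i != j).
  by have /eqP-> := H i j; rewrite /K4 (inj_eq perm_inj).
case: b {H} E => [[[[[b01 b02] b03] b12] b13] b23] E.
by move: (E i0 i1) (E i0 i2) (E i0 i3) (E i1 i2) (E i1 i3) (E i2 i3) => /= -> -> -> -> -> ->.
Qed.

(** * Sizes of the classes of tuples *)

Section TupleClasses.
Variables (p l : nat) (e : rel 'I_l).
Hypotheses (p_pr : prime p) (l_unit : l%:R != 0 :> 'F_p).

Definition affine_reindex (A : {ffun 'I_l -> 'F_p}) (u : {perm 'I_l} * 'F_p) :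
  {ffun 'I_l -> 'F_p} := [ffun i => A (u.1 i) + u.2].

Lemma tuple_equivP (A B : {ffun 'I_l -> 'F_p}) :
  reflect (exists u, B = affine_reindex A u) (tuple_equiv A B).
Proof.
apply: (iffP existsP) => [[s /existsP[a /forallP BE]]|[[s a] ->]].
  by exists (s, a); apply/ffunP => i; rewrite ffunE; exact/eqP.
by exists s; apply/existsP; exists a; apply/forallP => i; rewrite ffunE.
Qed.

Lemma tuple_equiv_refl (A : {ffun 'I_l -> 'F_p}) : tuple_equiv A A.
Proof.
by apply/tuple_equivP; exists (1%g, 0); apply/ffunP => i; rewrite ffunE perm1 addr0.
Qed.

Lemma tuple_equiv_sym (A B : {ffun 'I_l -> 'F_p}) : tuple_equiv A B -> tuple_equiv B A.
Proof.
case/tuple_equivP=> [[s a] ->]; apply/tuple_equivP; exists (s^-1%g, - a).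
by apply/ffunP => i; rewrite !ffunE /= permKV addrK.
Qed.

Lemma tuple_equiv_trans (A B C : {ffun 'I_l -> 'F_p}) :
  tuple_equiv A B -> tuple_equiv B C -> tuple_equiv A C.
Proof.
case/tuple_equivP=> [[s a] ->] /tuple_equivP[[s' a'] ->]; apply/tuple_equivP.
by exists ((s' * s)%g, a + a'); apply/ffunP => i; rewrite !ffunE /= permM addrA.
Qed.

Lemma tuple_equiv_good (A B : {ffun 'I_l -> 'F_p}) :
  tuple_equiv A B -> A \in good_tuples p e -> B \in good_tuples p e.
Proof.
case/tuple_equivP=> [[s a] ->]; rewrite !inE => /andP[/injectiveP A_inj].
case/existsP=> r /'forall_forallP rP; apply/andP; split.
  by apply/injectiveP => i j; rewrite !ffunE => /addIr /A_inj /perm_inj.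
apply/existsP; exists (s * r)%g; apply/'forall_forallP => i j; rewrite !permM.
rewrite -(eqP (rP (s i) (s j))) /graph_of /qr_adj !ffunE /=.
by rewrite opprD addrACA subrr addr0.
Qed.

(* Comparing the sums of the entries recovers the translation part, as l is invertible. *)
Lemma affine_reindex_inj (A : {ffun 'I_l -> 'F_p}) :
  injective A -> injective (affine_reindex A).
Proof.
move=> A_inj [s a] [s' a'] /ffunP AE.
have {}AE i : A (s i) + a = A (s' i) + a' by have := AE i; rewrite !ffunE.
have aa' : a = a'.
  have := eq_bigr _ (fun i (_ : true) => AE i) : \sum_i (A (s i) + a) = _.
  rewrite !big_split /= -!(reindex_inj (P := xpredT) (F := A) perm_inj).
  move/addrI; rewrite !sumr_const card_ord -[a *+ l]mulr_natl -[a' *+ l]mulr_natl.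
  exact: mulfI.
congr pair => //; apply/permP => i; apply: A_inj; have := AE i.
by rewrite aa' => /addIr.
Qed.

Lemma card_tuple_class (A : {ffun 'I_l -> 'F_p}) :
  injective A -> #|[set B | tuple_equiv A B]| = (l`! * p)%N.
Proof.
move=> A_inj; rewrite -card_Sn -[in RHS](card_Fp p_pr) -card_prod.
rewrite -(card_imset _ (affine_reindex_inj A_inj)); apply: eq_card => B.
rewrite !inE; apply/tuple_equivP/imsetP => [[u ->]|[u _ ->]]; by exists u.
Qed.

Lemma card_good_n_p : #|good_tuples p e| = (n_p p e * (l`! * p))%N.
Proof.
pose D := good_tuples p e.
(* Goodness is invariant under equivalence, so the classes of good tuples are the blocks of a
   partition of D. *)
have E A : A \in D -> [set B | tuple_equiv A B] = [set B in D | tuple_equiv A B].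
  move=> AD; apply/setP => B; rewrite !inE; apply/idP/andP => [AB|[]//].
  by have := tuple_equiv_good AB AD; rewrite inE.
rewrite /n_p (eq_in_imset E); apply: card_uniform_partition.
  move=> _ /imsetP[A AD ->]; rewrite -E // card_tuple_class //.
  by move: AD; rewrite inE => /andP[/injectiveP].
apply: equivalence_partitionP => A B C _ _ _; split; first exact: tuple_equiv_refl.
move=> AB; apply/idP/idP; apply: tuple_equiv_trans => //.
exact: tuple_equiv_sym.
Qed.

End TupleClasses.

(** * Counting the good 4-tuples *)

Section GoodTuples.
Variables (p k : nat).
Hypotheses (p_pr : prime p) (pE : p = (4 * k + 1)%N).
Local Notation F := 'F_p.

Lemma card_F : #|F| = (4 * k + 1)%N.
Proof. by rewrite card_Fp. Qed.

Definition tuple_pattern (A : {ffun 'I_4 -> F}) : edges6 :=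
  (qr_adj (A i0) (A i1), qr_adj (A i0) (A i2), qr_adj (A i0) (A i3),
   qr_adj (A i1) (A i2), qr_adj (A i1) (A i3), qr_adj (A i2) (A i3)).

Lemma qr_adjC (x y : F) : qr_adj x y = qr_adj y x.
Proof.
have E (u v : F) : qr_adj u v = (chi (u - v) == 1).
  rewrite /qr_adj /chi; case: eqVneq => //= _; case: existsP => _; by rewrite ?eqxx.
by rewrite !E (chiB card_F).
Qed.

Lemma qr_adjxx (x : F) : qr_adj x x = false.
Proof. by rewrite /qr_adj subrr eqxx. Qed.

Lemma graph_of_pattern (A : {ffun 'I_4 -> F}) :
  graph_of A =2 edges6_graph (tuple_pattern A).
Proof.
by elim/forall_ord4; elim/forall_ord4; rewrite /graph_of ?qr_adjxx //= qr_adjC.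
Qed.

Lemma injectiveb_ffun4 (T : eqType) (A : {ffun 'I_4 -> T}) :
  injectiveb A = [&& A i0 != A i1, A i0 != A i2, A i0 != A i3, A i1 != A i2,
    A i1 != A i3 & A i2 != A i3].
Proof.
apply/injectiveP/idP => [A_inj|]; first by rewrite !(inj_eq A_inj).
case/and5P=> h01 h02 h03 h12 /andP[h13 h23].
elim/forall_ord4; elim/forall_ord4 => // /eqP; rewrite ?(negbTE h01) ?(negbTE h02)
 ?(negbTE h03) ?(negbTE h12) ?(negbTE h13) ?(negbTE h23) //;
 by rewrite eq_sym ?(negbTE h01) ?(negbTE h02)
 ?(negbTE h03) ?(negbTE h12) ?(negbTE h13) ?(negbTE h23).
Qed.

(** Each factor [chi_sgn] vanishes at 0, so the product tests injectivity together with the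
    pattern. *)
Lemma pattern_prod_tuple b (A : {ffun 'I_4 -> F}) :
  pattern_prod b (A i0) (A i1) (A i2) (A i3) = (injectiveb A && (tuple_pattern A == b))%:R.
Proof.
case: b => [[[[[b01 b02] b03] b12] b13] b23].
rewrite /pattern_prod !chi_sgnE -!natrM !mulnb injectiveb_ffun4; congr (nat_of_bool _)%:R.
rewrite !xpair_eqE /qr_adj !subr_eq0.
case: (A i0 == A i1); case: (A i0 == A i2); case: (A i0 == A i3);
case: (A i1 == A i2); case: (A i1 == A i3); case: (A i2 == A i3); rewrite /= ?andbF //.
Qed.

Lemma good_tuplesE (e : rel 'I_4) (A : {ffun 'I_4 -> F}) :
  (A \in good_tuples p e)%:R = \sum_b (graph_iso (edges6_graph b) e)%:R *
     pattern_prod b (A i0) (A i1) (A i2) (A i3).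
Proof.
rewrite inE (bigD1 (tuple_pattern A)) // pattern_prod_tuple eqxx andbT big1 /=.
  by rewrite (eq_graph_iso _ (graph_of_pattern A)) -natrM mulnb andbC addr0.
move=> b; rewrite eq_sym => /negbTE bA.
by rewrite pattern_prod_tuple bA andbF mulr0.
Qed.

Lemma card_good_tuples (e : rel 'I_4) :
  #|good_tuples p e|%:R = p%:R * \sum_b \sum_s (graph_iso (edges6_graph b) e)%:R *
    (edge_sgn b s / 64) * edge_sum_val p%:R (K4_sum F) s.
Proof.
rewrite -sum1_card natr_sum big_mkcond /=.
transitivity (\sum_(A : {ffun 'I_4 -> F}) ((A \in good_tuples p e)%:R : rat)).
  by apply: eq_bigr => A _; case: ifP.
under [LHS]eq_bigr do rewrite good_tuplesE.
rewrite exchange_big mulr_sumr; apply: eq_bigr => b _ /=.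
rewrite -mulr_sumr (sum_ffun4 (fun x y z t => pattern_prod b x y z t)).
rewrite (sum_pattern_prod card_F) card_Fp // mulrCA; congr (_ * _).
by rewrite mulr_sumr; apply: eq_bigr => s _; rewrite [LHS]mulrA.
Qed.

Lemma natF0 : p%:R = 0 :> F.
Proof. exact/pcharf0/pchar_Fp. Qed.

Lemma J_sum : (J p k)%:~R = \sum_(x : F) chi (x ^+ 3 - x).
Proof.
have legendreE a : (legendre p a)%:~R = chi (a%:~R : F).
  by rewrite /legendre /chi; case: ifP => // _; case: ifP.
pose f i := chi (i%:R * i.+1%:R * i.+2%:R : F).
have -> : (J p k)%:~R = \sum_(1 <= i < (4 * k - 2).+1) f i.
  rewrite /J rmorph_sum; apply: eq_bigr => i _ /=.
  by rewrite legendreE !rmorphM.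
(* With x = i + 1 one has x^3 - x = i (i + 1) (i + 2). The full range has three more indices than J,
   namely 0, p - 2 and p - 1, whose terms vanish. *)
have -> : \sum_(x : F) chi (x ^+ 3 - x) = \sum_(0 <= i < p) f i.
  rewrite (reindex_inj (addIr 1)) -[in RHS](Fp_cast p_pr) big_mkord.
  apply: eq_bigr => i _ /=; rewrite /f -!natr1 natr_Zp; congr chi; ring.
have [k' kE] : exists k', k = k'.+1.
  by case: k pE p_pr => [->//|k' _ _]; exists k'.
have pE' : p = (4 * k').+3.+2 by rewrite pE kE; lia.
have -> : (4 * k - 2).+1 = (4 * k').+3 by rewrite kE; lia.
rewrite [in RHS]pE' [RHS]big_ltn // [in RHS]big_nat_recr // [in RHS]big_nat_recr //=.
have f0 : f 0%N = 0 by rewrite /f !mul0r chi0.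
have fp1 : f (4 * k').+4 = 0 by rewrite /f -pE' natF0 mulr0 mul0r chi0.
have fp2 : f (4 * k').+3 = 0 by rewrite /f -pE' natF0 mulr0 chi0.
by rewrite f0 fp1 fp2 add0r !addr0.
Qed.

Lemma K4_sum_d : K4_sum F = 32 * d p k + 4 - 2 * p%:R.
Proof.
by rewrite (K4_sumE card_F) -J_sum card_Fp // /d; field.
Qed.

(** The coefficients depend on e alone; p enters only through itself and [d p k]. The 24 is 4!, and
    the factor p of translations has cancelled. *)
Lemma n_pE (e : rel 'I_4) : (n_p p e)%:R = \sum_b \sum_s
  ((graph_iso (edges6_graph b) e)%:R * (edge_sgn b s / 64) / 24)
  * edge_sum_val p%:R (32 * d p k + 4 - 2 * p%:R) s.
Proof.
have four0 : 4%:R != 0 :> F.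
  have := natF_eq1 card_F; rewrite natrM; apply: contra_eq_neq => ->.
  by rewrite mul0r eq_sym oppr_eq0 oner_eq0.
have p0 : p%:R != 0 :> rat by rewrite pnatr_eq0 -lt0n prime_gt0.
have E := card_good_tuples e; rewrite (card_good_n_p e p_pr four0) K4_sum_d in E.
apply: (mulfI p0); apply: (mulfI (_ : 24 != 0 :> rat)) => //.
rewrite (_ : 24 * (p%:R * (n_p p e)%:R) = (n_p p e * (4`! * p))%:R); last first.
  by rewrite !natrM; ring.
rewrite E [RHS]mulrCA; congr (_ * _).
rewrite mulr_sumr; apply: eq_bigr => b _; rewrite mulr_sumr; apply: eq_bigr => s _.
by field.
Qed.

End GoodTuples.

(** * The counts as polynomials in k and d *)

Theorem theorem3p1 :
  (forall e : rel 'I_4, simple_graph e ->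
     exists P : {mpoly rat[2]},
       forall p k : nat, prime p -> p = (4 * k + 1)%N ->
         ((n_p p e)%:R : rat)
           = P.@[fun i : 'I_2 => if i == ord0 then (k%:R : rat) else d p k]) /\
  (forall p k : nat, prime p -> p = (4 * k + 1)%N ->
     ((n_p p K4)%:R : rat)
       = ((k%:R : rat) * (k%:R - 1) * (k%:R - 4) + 2 * k%:R * d p k) / 24).
Proof.
split=> [e _|p k p_pr pE].
  (* [q] and [t] are polynomial forms of p = 4k + 1 and of the K4 sum J^2 - 2 p = 32 d + 4 - 2 p. *)
  pose q : {mpoly rat[2]} := 4 * 'X_ord0 + 1.
  pose t : {mpoly rat[2]} := 32 * 'X_ord_max + 4 - 2 * q.
  exists (\sum_b \sum_s
    ((graph_iso (edges6_graph b) e)%:R * (edge_sgn b s / 64) / 24)%:MP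
    * edge_sum_val q t s) => p k p_pr pE.
  set v := fun i : 'I_2 => _.
  have qv : meval v q = p%:R.
    by rewrite rmorphD rmorphM rmorph_nat rmorph1 /= mevalXU pE natrD natrM.
  have tv : meval v t = 32 * d p k + 4 - 2 * p%:R.
    by rewrite rmorphB rmorphD !rmorphM !rmorph_nat /= mevalXU; congr (_ - 2 * _).
  rewrite (n_pE p_pr pE) rmorph_sum; apply: eq_bigr => b _.
  rewrite rmorph_sum; apply: eq_bigr => s _.
  by rewrite rmorphM rmorph_edge_sum_val /= mevalC; congr (_ * edge_sum_val _ _ s).
rewrite (n_pE p_pr pE); set v := edge_sum_val _ _.
(* Only the complete pattern is isomorphic to K4, so a single [b] survives. *)
rewrite (eq_bigr (fun b => if b == (true, true, true, true, true, true) then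
    (\sum_s edge_sgn b s / 64 * v s) / 24 else 0)); last first.
  move=> b _; rewrite graph_iso_K4; case: eqP => _; last first.
    by rewrite big1 // => s _; rewrite !mul0r.
  by rewrite mulr_suml; apply: eq_bigr => s _; rewrite mul1r mulrAC.
by rewrite -big_mkcond big_pred1_eq sum_edge_sum_val pE natrD natrM; field.
Qed.
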